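(* Let $K$ be a compact space and $\kappa$ a cardinal. Let $\{U_\alpha:\alpha<\kappa\}$ be a family of pairwise disjoint non-empty clopen subsets of $K$ such that each $U_\alpha$ admits a Cantor scheme of clopen subsets. Then each of the following sets, with the zero function added to it, contains an isometric copy of $c_0(\kappa)$: (i) $\{f\in C(K):\operatorname{rng}(f)\text{ has cardinality continuum}\}$; (ii) $\{f\in C(K):\operatorname{rng}(f)\text{ is an interval}\}$; (iii) $\{f\in C(K):\operatorname{rng}(f)\text{ is homeomorphic to the Cantor set}\}$.
   Context: $C(K)$ is the Banach space of real-valued continuous functions on $K$ with the supremum norm; $\operatorname{rng}(f)=f(K)$. A Cantor scheme in a non-empty set $X$ is a family $\{A_s:s\in\{0,1\}^{<\mathbb{N}}\}$ of non-empty subsets of $X$ indexed by finite 0-1 sequences such that (i) $A_\emptyset=X$, where $\emptyset$ is the empty sequence; (ii) $A_{s\hat{\ }i}\subseteq A_s$ for every $s$ and $i=0,1$, where $s\hat{\ }i$ is $s$ extended by $i$; (iii) $A_{s\hat{\ }0}\cap A_{s\hat{\ }1}=\emptyset$ for every $s$. A set $U_\alpha$ admits a Cantor scheme of clopen subsets if there is a Cantor scheme in $X=U_\alpha$ all of whose members are clopen. For a cardinal $\kappa$, $c_0(\kappa)=\{x\in\mathbb{R}^\kappa : \{\alpha<\kappa : |x(\alpha)|>\varepsilon\}\text{ is finite for every }\varepsilon>0\}$, with the supremum norm. An isometric copy of a Banach space $Z$ in $C(K)$ means a linear subspace of $C(K)$ which is the image of $Z$ under a linear isometry. *)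

(* Defs.v *)
From HB Require Import structures.
From mathcomp Require Import all_boot all_order all_algebra.
From mathcomp Require Import all_classical all_reals all_analysis.

Set Implicit Arguments.
Unset Strict Implicit.
Unset Printing Implicit Defensive.

Import Order.TTheory GRing.Theory Num.Theory.
Import numFieldTopology.Exports numFieldNormedType.Exports.

Local Open Scope classical_set_scope.
Local Open Scope ring_scope.

Section SupNorm.
Context {R : realType} {T : Type}.
Implicit Types f g : T -> R.

(* When [T] is empty this is [sup set0 = 0]. *)
Definition sup_norm f : R := sup (range (fun x => `|f x|)).

Definition sup_bounded f : Prop := exists M, forall x, `|f x| <= M.

Lemma sup_norm_ub f x : sup_bounded f -> `|f x| <= sup_norm f.
Proof.
move=> [M fM]; apply: sup_upper_bound; last by exists x.
by split; [exists `|f x|, x | exists M => _ [y _ <-]].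
Qed.

Lemma sup_norm_le f M : 0 <= M -> (forall x, `|f x| <= M) -> sup_norm f <= M.
Proof.
move=> M0 fM; have [ne|/set0P/negP/negPn/eqP e0] := pselect (range (fun x => `|f x|) !=set0).
  by apply: ge_sup => // _ [x _ <-].
by rewrite /sup_norm e0 sup0.
Qed.

Lemma sup_norm_ge0 f : 0 <= sup_norm f.
Proof.
rewrite /sup_norm; have [hs|hs] := pselect (has_sup (range (fun x => `|f x|))).
  have [_ [x _ _]] := hs.1; apply: le_trans (normr_ge0 (f x)) _.
  by apply: sup_upper_bound => //; exists x.
by rewrite sup_out.
Qed.

Lemma sup_normD f g : sup_bounded f -> sup_bounded g ->
  sup_norm (f + g) <= sup_norm f + sup_norm g.
Proof.
move=> bf bg; apply: sup_norm_le => [|x]; first by rewrite addr_ge0 ?sup_norm_ge0.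
by apply: le_trans (ler_normD _ _) _; rewrite lerD ?sup_norm_ub.
Qed.

Lemma sup_normZ (a : R) f : sup_bounded f ->
  sup_norm (a *: f) = `|a| * sup_norm f.
Proof.
move=> bf; have [->|a0] := eqVneq a 0.
  rewrite scale0r normr0 mul0r; apply/eqP; rewrite eq_le sup_norm_ge0 andbT.
  by apply: sup_norm_le => // x; rewrite normr0.
have le1 (b : R) h : sup_bounded h -> sup_norm (b *: h) <= `|b| * sup_norm h.
  move=> bh; apply: sup_norm_le => [|x]; first by rewrite mulr_ge0 ?sup_norm_ge0.
  by rewrite [X in `|X|]/(b * h x) normrM ler_wpM2l ?sup_norm_ub.
apply/eqP; rewrite eq_le le1//= -ler_pdivlMl ?normr_gt0// -normfV.
have {1}-> : f = a^-1 *: (a *: f) by rewrite scalerA mulVf// scale1r.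
apply: le1; case: bf => M fM; exists (`|a| * M) => x.
by rewrite [X in `|X|]/(a * f x) normrM ler_wpM2l.
Qed.

Lemma sup_norm0_eq0 f : sup_bounded f -> sup_norm f = 0 -> f = 0.
Proof.
move=> bf f0; apply/funext => x; apply/eqP.
by rewrite -normr_le0 -f0 sup_norm_ub.
Qed.

End SupNorm.

Section ContinuousFunctions.
Context (R : realType) (K : topologicalType).

Definition continuous_pred : {pred K -> R} := mem [set f : K -> R | continuous f].

Lemma continuous_submod_closed : submod_closed continuous_pred.
Proof.
split=> [|a f g]; first by rewrite inE => x; exact: cvg_cst.
rewrite !inE /= => cf cg x; apply: cvgD; last exact: cg.
by apply: cvgZr; exact: cf.
Qed.

HB.instance Definition _ :=
  GRing.isSubmodClosed.Build R (K -> R) continuous_pred continuous_submod_closed.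

(* The space C(K).  The compactness of [K] is a parameter because the supremum
   is a norm only on bounded functions. *)
Record contfun (cK : compact [set: K]) : Type :=
  ContFun { contfun_val :> K -> R; contfunP : contfun_val \in continuous_pred }.

Context (cK : compact [set: K]).

HB.instance Definition _ := [isSub for @contfun_val cK].
HB.instance Definition _ := [Choice of contfun cK by <:].
HB.instance Definition _ := [SubChoice_isSubLmodule of contfun cK by <:].

Lemma contfun_bounded (f : contfun cK) : sup_bounded f.
Proof.
have cf : continuous f by have := contfunP f; rewrite inE.
have /compact_bounded[M [_ fM]] :=
  continuous_compact (continuous_subspaceT cf) cK.
by exists (M + 1) => x; apply: fM; [rewrite ltrDl | exists x].
Qed.

Let contfun_normD (f g : contfun cK) :
  sup_norm (f + g) <= sup_norm f + sup_norm g.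
Proof. exact: sup_normD (contfun_bounded f) (contfun_bounded g). Qed.

Let contfun_normZ (a : R) (f : contfun cK) :
  sup_norm (a *: f) = `|a| * sup_norm f.
Proof. exact: sup_normZ (contfun_bounded f). Qed.

Let contfun_norm0_eq0 (f : contfun cK) : sup_norm f = 0 -> f = 0.
Proof. by move=> f0; apply/val_inj/(sup_norm0_eq0 (contfun_bounded f)). Qed.

HB.instance Definition _ := Lmodule_isNormed.Build R (contfun cK)
  contfun_normD contfun_normZ contfun_norm0_eq0.

Lemma contfun_normE (f : contfun cK) : `|f| = sup_norm f.
Proof. by []. Qed.

End ContinuousFunctions.

Section C0.
Context (R : realType) (I : Type).

Definition c0_pred : {pred I -> R} :=
  mem [set x : I -> R | forall e : R, 0 < e -> finite_set [set i | e < `|x i|]].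

Lemma c0_submod_closed : submod_closed c0_pred.
Proof.
split=> [|a f g].
  rewrite inE => e e0; apply: (sub_finite_set _ (finite_set0 I)) => i /=.
  by rewrite normr0 ltNge ltW.
rewrite !inE /= => cf cg e e0.
have d0 : 0 < e / 2 / (`|a| + 1) by rewrite !divr_gt0// ltr_wpDl.
have e20 : 0 < e / 2 by rewrite divr_gt0.
have := cf _ d0; have := cg _ e20.
set G := [set i | _]; set F := [set i | _] => finG finF.
apply: (@sub_finite_set _ _ (F `|` G)); last by rewrite finite_setU.
move=> i /= ei; apply: contrapT => /not_orP[/negP + /negP].
rewrite -!leNgt => fi gi; move: ei; apply/negP; rewrite -leNgt.
apply: le_trans (ler_normD _ _) _; rewrite [leRHS]splitr lerD//.
rewrite [X in `|X|]/(a * f i) normrM.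
move: fi; rewrite ler_pdivlMr ?ltr_wpDl// => /(le_trans _); apply.
by rewrite mulrC ler_wpM2l// lerDl.
Qed.

HB.instance Definition _ :=
  GRing.isSubmodClosed.Build R (I -> R) c0_pred c0_submod_closed.

Record c0 : Type := C0 { c0_val :> I -> R; c0P : c0_val \in c0_pred }.

HB.instance Definition _ := [isSub for c0_val].
HB.instance Definition _ := [Choice of c0 by <:].
HB.instance Definition _ := [SubChoice_isSubLmodule of c0 by <:].

Lemma c0_bounded (x : c0) : sup_bounded x.
Proof.
have := c0P x; rewrite inE => /(_ 1 ltr01) finx.
have /finite_seqP[s sE] := finite_image (fun i => `|x i|) finx.
exists (\sum_(y <- s) `|y| + 1) => i.
have [x1|x1] := leP `|x i| 1.
  by apply: le_trans x1 _; rewrite lerDr sumr_ge0.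
have xs : `|x i| \in s.
  by have : [set` s] `|x i| by rewrite -sE; exists i.
rewrite (big_rem _ xs) /= normr_id -addrA lerDl addr_ge0// sumr_ge0//.
Qed.

Let c0_normD (x y : c0) : sup_norm (x + y) <= sup_norm x + sup_norm y.
Proof. exact: sup_normD (c0_bounded x) (c0_bounded y). Qed.

Let c0_normZ (a : R) (x : c0) : sup_norm (a *: x) = `|a| * sup_norm x.
Proof. exact: sup_normZ (c0_bounded x). Qed.

Let c0_norm0_eq0 (x : c0) : sup_norm x = 0 -> x = 0.
Proof. by move=> x0; apply/val_inj/(sup_norm0_eq0 (c0_bounded x)). Qed.

HB.instance Definition _ :=
  Lmodule_isNormed.Build R c0 c0_normD c0_normZ c0_norm0_eq0.

Lemma c0_normE (x : c0) : `|x| = sup_norm x.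
Proof. by []. Qed.

End C0.

Definition isometric_copy (R : realType) (Z W : normedModType R)
    (V : set W) : Prop :=
  exists T : {linear Z -> W}, (forall z, `|T z| = `|z|) /\ V = range T.

Definition contains_isometric_copy (R : realType) (Z W : normedModType R)
    (S : set W) : Prop :=
  exists V : set W, isometric_copy Z V /\ V `<=` S.

Definition cantor_scheme (T : Type) (X : set T) (A : seq bool -> set T) : Prop :=
  [/\ forall s, A s !=set0,
      A [::] = X,
      forall s i, A (rcons s i) `<=` A s &
      forall s, A (rcons s false) `&` A (rcons s true) = set0].

(* For a clopen [X], clopen in [T] and clopen in the subspace [X] mean the
   same thing for subsets of [X]. *)
Definition admits_clopen_cantor_scheme (T : topologicalType) (X : set T) : Prop :=
  exists A, cantor_scheme X A /\ forall s, clopen (A s).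

Definition homeomorphic (S T : topologicalType) : Prop :=
  exists (f : S -> T) (g : T -> S),
    [/\ continuous f, continuous g, cancel f g & cancel g f].

Definition has_card_continuum (R : realType) (E : set R) : Prop :=
  (E #= [set: R])%card.

(* [is_interval] is order convexity, which also holds of [set0] and of
   singletons; an interval is understood here to have distinct points. *)
Definition proper_interval (R : realType) (E : set R) : Prop :=
  is_interval E /\ exists x y, [/\ E x, E y & x < y].

(* [set_type E] carries the topology induced on [E] by the line. *)
Definition homeomorphic_to_cantor (R : realType) (E : set R) : Prop :=
  homeomorphic (set_type E) cantor_space.

(* Main.v *)
(** Sending a point of [U a] to the branch of the Cantor scheme it follows
gives, by compactness of [K], a continuous surjection of [U a] onto the Cantor
space, hence (Alexandroff-Hausdorff) a continuous map [phi a] of [U a] onto any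
prescribed compact set [C] of reals.  If [C] contains 0 and 1 and lies in
[[-1, 1]], then [T x], equal to [x a * phi a] on [U a] and to 0 off the union
of the [U a], is a linear isometry of [c0] into [C(K)], and for nonzero [x] the
range of [T x] is the union of the sets [x a * C].  For [C = [0, 1]] this is a
nondegenerate interval.  For the ternary set it is compact, perfect and, since
away from 0 only finitely many nowhere dense sets [x a * C] matter, without
interior; so it is a Cantor set. *)

Require Import Defs.
From HB Require Import structures.
From mathcomp Require Import all_boot all_order all_algebra.
From mathcomp Require Import all_classical all_reals all_analysis.
From mathcomp Require Import lra.

Set Implicit Arguments.
Unset Strict Implicit.
Unset Printing Implicit Defensive.

Import Order.TTheory GRing.Theory Num.Theory.
Import numFieldTopology.Exports numFieldNormedType.Exports.

Local Open Scope classical_set_scope.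
Local Open Scope ring_scope.

(** * Coding points by the branches of a Cantor scheme *)

(* The members of a scheme at level [n] need not cover: at each step the points
   outside the left child, even those in neither child, go right. *)
Fixpoint scheme_address (T : Type) (A : seq bool -> set T) (n : nat) (y : T) :
    seq bool :=
  if n is m.+1 then
    let s := scheme_address A m y in rcons s (~~ `[< A (rcons s false) y >])
  else [::].

Definition scheme_code (T : Type) (A : seq bool -> set T) (y : T) :
    cantor_space :=
  fun n => ~~ `[< A (rcons (scheme_address A n y) false) y >].

(** Each further bit is decided by membership in one clopen set, so a neighbourhood on which the
    first bits agree shrinks to one on which the next agrees too. *)
Lemma scheme_address_locally_constant (K : topologicalType)
    (A : seq bool -> set K) (n : nat) (y : K) : (forall s, clopen (A s)) ->
  \forall z \near y, scheme_address A n z = scheme_address A n y.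
Proof.
move=> clA; elim: n => [|n IHn]; first by near=> z.
have same_bit : \forall z \near y,
    `[< A (rcons (scheme_address A n y) false) z >] =
    `[< A (rcons (scheme_address A n y) false) y >].
  have [oA cA] := clA (rcons (scheme_address A n y) false).
  have [Ay|nAy] := pselect (A (rcons (scheme_address A n y) false) y).
    have := open_nbhs_nbhs (conj oA Ay); apply: filterS => z Az.
    by rewrite !asboolT.
  have := open_nbhs_nbhs (conj (closed_openC cA) nAy); apply: filterS => z Az.
  by rewrite !asboolF.
by near=> z => /=; rewrite (near IHn z) // (near same_bit z).
Unshelve. all: by end_near.
Qed.

Lemma scheme_code_continuous (K : topologicalType) (A : seq bool -> set K) :
  (forall s, clopen (A s)) -> continuous (scheme_code A).
Proof.
move=> clA y; apply/cvg_sup => n V [_ [[W _ <-] Wy WV]].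
(* In the product topology coordinate [n] suffices; it is the last bit of the address of length
   [n.+1]. *)
have := scheme_address_locally_constant n.+1 y clA; apply: filterS => z /=.
move=> /rcons_inj[_ zy]; apply: WV.
by rewrite /preimage /= /scheme_code zy.
Qed.

(** The members of the scheme along [b] are nested, closed and non-empty, so compactness gives a
    point [y] in all of them; disjointness of siblings then forces the code of [y] to be [b]. *)
Lemma scheme_code_surj (K : topologicalType) (A : seq bool -> set K)
    (X : set K) (b : cantor_space) : compact [set: K] ->
  cantor_scheme X A -> (forall s, closed (A s)) ->
  exists2 y, X y & scheme_code A y = b.
Proof.
move=> cK [A_ne A_X A_sub A_disj] clA.
pose s n := mkseq b n.
have sS n : s n.+1 = rcons (s n) (b n) by rewrite /s mkseqS.
have s_decr m n : (m <= n)%N -> A (s n) `<=` A (s m).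
  elim: n => [|n IHn]; first by rewrite leqn0 => /eqP ->.
  rewrite leq_eqVlt => /predU1P[->//|/IHn]; apply: subset_trans.
  by rewrite sS; exact: A_sub.
pose F := filter_from [set: nat] (fun n => A (s n)).
have PF : ProperFilter F.
  apply: filter_from_proper; last by move=> n _; exact: A_ne.
  apply: filter_from_filter; first by exists 0%N.
  move=> m n _ _; exists (maxn m n) => // y Ay.
  by split; apply: s_decr Ay; rewrite ?leq_maxl ?leq_maxr.
have [y [_ cly]] := cK _ PF (@filterT _ F _).
have Ay n : A (s n) y.
  have /closure_id -> := clA (s n).
  by move: cly; rewrite clusterE; apply; exists n.
have bit n : ~~ `[< A (rcons (s n) false) y >] = b n.
  have := Ay n.+1; rewrite sS; case: (b n) => Asy; last by rewrite asboolT.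
  rewrite asboolF// => Asy0.
  by have : set0 y by rewrite -(A_disj (s n)).
have address n : scheme_address A n y = s n.
  by elim: n => //= n ->; rewrite sS bit.
exists y; first by have := Ay 0%N; rewrite A_X.
by apply/funext => n; rewrite /scheme_code address bit.
Qed.

(** * Sets of reals as images and as copies of the Cantor space *)

Lemma compact_set_type (X : topologicalType) (E : set X) :
  compact E -> compact [set: set_type E].
Proof.
move=> cE F PF _.
have FE : (set_val @ F) E.
  by apply: (@filterS _ F _ setT) filterT => e _; exact: set_valP.
have [x [Ex clx]] := cE _ (fmap_proper_filter _ PF) FE.
exists (exist _ x (mem_set Ex)); split=> // A B FA [_ [[V oV <-] Vx VB]].
have Vnx : nbhs x V by exact: open_nbhs_nbhs.
have FA' : (set_val @ F) (set_val @` A).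
  by apply: (@filterS _ F _ A) FA => a Aa; exists a.
by have [_ [[a Aa <-] Va]] := clx _ _ FA' Vnx; exists a; split=> //; exact: VB.
Qed.

Lemma hausdorff_set_type (X : topologicalType) (E : set X) :
  hausdorff_space X -> hausdorff_space (set_type E).
Proof.
move=> hX x y clxy; apply/val_inj/hX => A B Ax By.
by have [z [Az Bz]] := clxy _ _ (initial_continuous Ax) (initial_continuous By);
  exists (set_val z).
Qed.

(* A copy of [set_type E] that can carry the base point required by
   [cantor_surj] and [homeomorphism_cantor_like]. *)
Definition pointed_set_type (X : Type) (E : set X) (e : set_type E) : Type :=
  set_type E.

HB.instance Definition _ (R : realType) (X : pseudoMetricType R) (E : set X)
    (e : set_type E) :=
  PseudoMetric.copy (pointed_set_type e) (set_type E).
HB.instance Definition _ (R : realType) (X : pseudoMetricType R) (E : set X)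
    (e : set_type E) :=
  isPointed.Build (pointed_set_type e) e.

Lemma cantor_surj_set (R : realType) (E : set R) : compact E -> E !=set0 ->
  exists2 g : cantor_space -> R, continuous g & range g = E.
Proof.
move=> cE [e Ee].
have [f cf] := @cantor_surj R (pointed_set_type (exist _ e (mem_set Ee)))
  (compact_set_type cE) (hausdorff_set_type (@Rhausdorff R)).
exists (set_val \o f) => [b|].
  by apply: continuous_comp; [exact: cf | exact: initial_continuous].
apply/seteqP; split=> [_ [b _ <-]|x Ex]; first exact: set_valP.
have [b _ fb] := @surj _ _ _ _ f (exist _ x (mem_set Ex)) I.
by exists b => //=; rewrite fb.
Qed.

(** This is Brouwer's characterisation of the Cantor space, read on the subspace [E]; a point of [E]
    serves as base point. *)
Lemma homeomorphic_to_cantorP (R : realType) (E : set R) : E !=set0 ->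
  cantor_like (set_type E) -> homeomorphic_to_cantor E.
Proof.
move=> [e Ee] cantorE.
have [f [cf clf]] := @homeomorphism_cantor_like R
  (pointed_set_type (exist _ e (mem_set Ee))) cantorE.
exists (f^-1)%FUN, f; split=> //.
(* Preimages under the inverse are images under [f], which is a closed map. *)
- apply/continuous_closedP => A /clf; congr closed.
  apply/seteqP; split=> [_ [b Ab <-]|x Ax].
    by rewrite /preimage /= funK ?inE.
  by exists (f^-1%FUN x) => //; rewrite invK ?inE.
- by move=> x; rewrite invK ?inE.
- by move=> x; rewrite funK ?inE.
Qed.

(** * The ternary Cantor set: compact, perfect, nowhere dense *)

Section TernaryCantorSet.
Context (R : realType).

(** The maps [3 * x] and [3 * x - 2] invert the two contractions that generate the Cantor set, so
    the recursion exhibits self-similarity directly. *)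
Fixpoint ternary_stage (n : nat) : set R :=
  if n is m.+1 then
    [set x | ternary_stage m (3 * x) \/ ternary_stage m (3 * x - 2)]
  else `[0, 1].

Definition ternary_set : set R := [set x | forall n, ternary_stage n x].

Lemma ternary_stage01 n x : ternary_stage n x -> 0 <= x <= 1.
Proof.
elim: n x => [x|n IHn x [/IHn|/IHn] /andP[x0 x1]]; last 2 first.
- by apply/andP; split; lra.
- by apply/andP; split; lra.
by rewrite /= in_itv.
Qed.

Lemma ternary_set01 x : ternary_set x -> 0 <= x <= 1.
Proof. by move=> /(_ 0%N); exact: ternary_stage01. Qed.

Lemma ternary_setP x :
  ternary_set x <-> ternary_set (3 * x) \/ ternary_set (3 * x - 2).
Proof.
split=> [Cx|Cx n].
  (* Comparing [3 * x] with 2 settles the alternative for all stages at once, since every stage lies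
     in [[0, 1]]. *)
  have [x_lt|x_ge] := ltP (3 * x) 2.
    left=> n; have [//|/ternary_stage01/andP[]] := Cx n.+1; lra.
  right=> n; have [/ternary_stage01/andP[]|//] := Cx n.+1; lra.
have S_n1 : ternary_stage n.+1 x by case: Cx => /(_ n); [left | right].
case: n S_n1 => [/ternary_stage01|n _]; first by rewrite /= in_itv.
by case: Cx => /(_ n); [left | right].
Qed.

Lemma ternary_set0 : ternary_set 0.
Proof.
by elim=> [|n IHn] /=; [rewrite in_itv /= lexx ler01 | left; rewrite mulr0].
Qed.

Lemma ternary_set1 : ternary_set 1.
Proof.
elim=> [|n IHn] /=; first by rewrite in_itv /= lexx ler01.
by right; have -> : 3 * 1 - 2 = 1 :> R by lra.
Qed.

Lemma closed_ternary_set : closed ternary_set.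
Proof.
have -> : ternary_set = \bigcap_n ternary_stage n.
  by apply/seteqP; split=> x Cx n; [move=> _|]; exact: Cx.
apply: closed_bigI => n _; elim: n => [|n IHn]; first exact: interval_closed.
have cM : continuous (fun x : R => 3 * x).
  by move=> x; apply: cvgM; [exact: cvg_cst | exact: cvg_id].
have cMB : continuous (fun x : R => 3 * x - 2).
  by move=> x; apply: cvgB; [exact: cM | exact: cvg_cst].
by apply: closedU; apply: closed_comp IHn => x _; [exact: cM | exact: cMB].
Qed.

Lemma compact_ternary_set : compact ternary_set.
Proof.
apply: subclosed_compact (@segment_compact R 0 1) _.
  exact: closed_ternary_set.
by move=> x /ternary_set01; rewrite /= in_itv.
Qed.

Lemma ternary_set_perfect x (e : R) : ternary_set x -> 0 < e ->
  exists y, [/\ ternary_set y, y != x & `|y - x| < e].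
Proof.
move=> Cx e0.
(* Zooming in [n] times reduces to finding a second point of the set at
   distance at most 1, and 0 or 1 will do. *)
suff [n lt_ne] : exists n, (3 ^+ n)^-1 < e.
  have [y [Cy yx /le_lt_trans ye]] : exists y,
      [/\ ternary_set y, y != x & `|y - x| <= (3 ^+ n)^-1].
    elim: n {lt_ne} x Cx => [|n IHn] x Cx.
      have /andP[x0 x1] := ternary_set01 Cx.
      have [->|x_neq0] := eqVneq x 0.
        exists 1; rewrite oner_eq0 subr0 normr1 expr0 invr1.
        by split=> //; exact: ternary_set1.
      exists 0; rewrite eq_sym x_neq0 sub0r normrN ger0_norm// expr0 invr1.
      by split=> //; exact: ternary_set0.
    have zoom c : ternary_set (3 * x - c) ->
        (forall y, ternary_set (3 * y - c) -> ternary_set y) ->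
        exists y, [/\ ternary_set y, y != x & `|y - x| <= (3 ^+ n.+1)^-1].
      move=> /IHn[y [Cy yx ye]] hC; exists ((y + c) / 3); split.
      - by apply: hC; have -> : 3 * ((y + c) / 3) - c = y by lra.
      - by apply: contraNN yx => /eqP <-; apply/eqP; lra.
      - have -> : (y + c) / 3 - x = (y - (3 * x - c)) / 3 by lra.
        by rewrite normrM [X in _ * X]ger0_norm// exprSr invfM ler_wpM2r.
    case/ternary_setP: (Cx) => Cx'.
      apply: (zoom 0) => [|y]; rewrite subr0// => Cy.
      by apply/ternary_setP; left.
    by apply: (zoom 2) => // y Cy; apply/ternary_setP; right.
  by exists y; split=> //; exact: ye.
(* For this [n], [e^-1 < n < 3 ^+ n]. *)
exists (Num.truncn e^-1).+1; rewrite invf_plt ?posrE ?exprn_gt0//.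
apply: lt_le_trans (truncnS_gt _) _; rewrite -natrX ler_nat ltnW//.
by rewrite ltn_expl.
Qed.

Lemma ternary_set_gap (u v : R) : u < v ->
  exists z, [/\ u < z, z < v & ~ ternary_set z].
Proof.
move=> uv; apply: contrapT => no_gap.
have {no_gap} Cuv z : u < z < v -> ternary_set z.
  by move=> /andP[uz zv]; apply: contrapT => nCz; apply: no_gap; exists z.
have [n lt_n] : exists n, 1 < 3 ^+ n * (v - u).
  exists (Num.truncn (v - u)^-1).+1; rewrite -ltr_pdivrMr ?subr_gt0// div1r.
  apply: lt_le_trans (truncnS_gt _) _; rewrite -natrX ler_nat ltnW//.
  by rewrite ltn_expl.
(* An interval inside the set misses the middle third, so zooming in gives an
   interval inside the set that is three times as long. *)
elim: n u v uv Cuv lt_n => [|n IHn] u v uv Cuv lt_n.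
  (* At [n = 0] the interval is longer than 1, yet it must lie in [[0, 1]]. *)
  have u0 : 0 <= u.
    rewrite leNgt; apply/negP => u0.
    have [z []] : exists z, [/\ u < z, z < v & z < 0].
      have [v0|v0] := leP v 0; first by exists ((u + v) / 2); split; lra.
      by exists (u / 2); split; lra.
    move=> uz zv z0; have /Cuv/ternary_set01/andP[] : u < z < v by rewrite uz.
    by lra.
  have v1 : v <= 1.
    rewrite leNgt; apply/negP => v1.
    have [z []] : exists z, [/\ u < z, z < v & 1 < z].
      have [u1|u1] := leP 1 u; first by exists ((u + v) / 2); split; lra.
      by exists ((v + 1) / 2); split; lra.
    move=> uz zv z1; have /Cuv/ternary_set01/andP[] : u < z < v by rewrite uz.
    by lra.
  by lra.
have gap z : u < z < v -> 3 * z <= 1 \/ 2 <= 3 * z.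
  move=> /Cuv/ternary_setP[/ternary_set01|/ternary_set01] /andP[? ?].
    by left; lra.
  by right; lra.
have [v_le|v_gt] := leP (3 * v) 2.
  apply: (IHn (3 * u) (3 * v)); [lra| |by rewrite exprSr in lt_n; lra].
  move=> z /andP[z_gt z_lt].
  have /Cuv/ternary_setP[] : u < z / 3 < v by apply/andP; split; lra.
    by have -> : 3 * (z / 3) = z by lra.
  by move=> /ternary_set01/andP[]; lra.
apply: (IHn (3 * u - 2) (3 * v - 2)); [lra| |by rewrite exprSr in lt_n; lra].
(* Otherwise the interval would contain 1/2, inside the removed middle third. *)
have u_ge : 1 <= 3 * u.
  rewrite leNgt; apply/negP => u_lt.
  have [z [uz zv z1 z2]] : exists z, [/\ u < z, z < v, 1 < 3 * z & 3 * z < 2].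
    by exists (1 / 2); split; lra.
  by have := gap z; rewrite uz zv => /(_ isT)[]; lra.
move=> z /andP[z_gt z_lt].
have z3 : u < (z + 2) / 3 < v by apply/andP; split; lra.
have /ternary_setP[/ternary_set01/andP[_]|] := Cuv _ z3; last first.
  by have -> : 3 * ((z + 2) / 3) - 2 = z by lra.
by lra.
Qed.

End TernaryCantorSet.

(** * The isometric embedding and the ranges of its values *)

Definition star_union (R : realType) (I : Type) (x : I -> R) (C : set R) :
    set R :=
  [set r | exists a, exists2 t, C t & r = x a * t].

Lemma fun_neq0 (R : realType) (I : Type) (x : I -> R) :
  x <> (fun=> 0) -> exists a, x a != 0.
Proof.
move=> x_neq0; apply: contrapT => no_a; apply: x_neq0; apply/funext => a.
by apply/eqP/negPn/negP => xa; apply: no_a; exists a.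
Qed.

Section DisjointSums.
Context (R : realType) (K : topologicalType) (cK : compact [set: K])
  (kappa : Type) (U : kappa -> set K) (phi : kappa -> K -> R) (C : set R).
Hypothesis U_disjoint : trivIset [set: kappa] U.
Hypothesis U_clopen : forall a, clopen (U a).
Hypothesis phi_continuous : forall a, continuous (phi a).
Hypothesis phi_image : forall a, phi a @` U a = C.
Hypothesis C0 : C 0.
Hypothesis C1 : C 1.
Hypothesis C_le1 : forall t, C t -> `|t| <= 1.

Let index (y : K) : option kappa :=
  if pselect (exists a, U a y) is left Uy then Some (projT1 (cid Uy)) else None.

Let indexP a y : U a y -> index y = Some a.
Proof.
rewrite /index => Uay; case: pselect => [Uy|[]]; last by exists a.
congr Some; apply: U_disjoint => //.
by exists y; split=> //; exact: projT2 (cid Uy).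
Qed.

Let index_None y : index y = None -> forall a, ~ U a y.
Proof. by move=> + a /indexP => ->. Qed.

Let index_Some y a : index y = Some a -> U a y.
Proof.
by rewrite /index; case: pselect => // Uy [<-]; exact: projT2 (cid Uy).
Qed.

Definition disjoint_sum (x : kappa -> R) (y : K) : R :=
  if index y is Some a then x a * phi a y else 0.

Lemma disjoint_sumE x a y : U a y -> disjoint_sum x y = x a * phi a y.
Proof. by rewrite /disjoint_sum => /indexP ->. Qed.

(** On the open set [U a] the sum is the product [x a * phi a]. Off the union, the finitely many
    [U a] with large [x a] form a closed set missing [y], and outside it the sum is small. *)
Lemma disjoint_sum_continuous (x : c0 R kappa) : continuous (disjoint_sum x).
Proof.
move=> y; case yE: (index y) => [a|].
  have Uay := index_Some yE; have [oU _] := U_clopen a.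
  have near_eq : \forall z \near y, x a * phi a z = disjoint_sum x z.
    have := open_nbhs_nbhs (conj oU Uay); apply: filterS => z Uaz.
    by rewrite (disjoint_sumE _ Uaz).
  rewrite /continuous_at (disjoint_sumE _ Uay).
  apply: cvg_trans; first exact: near_eq_cvg near_eq.
  by apply: cvgM; [exact: cvg_cst | exact: phi_continuous].
have y0 : disjoint_sum x y = 0 by rewrite /disjoint_sum yE.
rewrite /continuous_at y0; apply/cvgr0Pnorm_lt => e e0.
(* The threshold [e / 2] turns the weak bound on the product into a strict bound by [e]. *)
have := c0P x; rewrite inE => /(_ (e / 2)).
rewrite divr_gt0// => /(_ isT) fin_big.
pose B := \bigcup_(a in ([set a | e / 2 < `|x a|] : set {classic kappa})) U a.
have cB : closed B.
  by apply: closed_bigcup => // a _; have [] := U_clopen a.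
have nBy : (~` B) y by move=> [a _]; exact: index_None.
have := open_nbhs_nbhs (conj (closed_openC cB) nBy); apply: filterS => z nBz.
rewrite /disjoint_sum; case zE: (index z) => [a|]; last by rewrite normr0.
have Uaz := index_Some zE.
have xa : `|x a| <= e / 2.
  by rewrite leNgt; apply/negP => big_a; apply: nBz; exists a.
have phi_le1 : `|phi a z| <= 1.
  by apply/C_le1; rewrite -(phi_image a); exists z.
rewrite normrM; apply: (@le_lt_trans _ _ (e / 2 * 1)).
  by apply: ler_pM.
by rewrite mulr1; lra.
Qed.

Definition disjoint_sum_contfun (x : c0 R kappa) : contfun R cK :=
  ContFun cK (mem_set (@disjoint_sum_continuous x)).

Lemma disjoint_sum_contfun_linear : linear disjoint_sum_contfun.
Proof.
move=> k u v; apply/val_inj/funext => y.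
change (disjoint_sum (k *: u + v) y = k * disjoint_sum u y + disjoint_sum v y).
rewrite /disjoint_sum; case: (index y) => [a|]; last by rewrite mulr0 addr0.
by rewrite [(k *: u + v) a]/(k * u a + v a) mulrDl mulrA.
Qed.

HB.instance Definition _ := GRing.isLinear.Build R (c0 R kappa) (contfun R cK)
  *:%R disjoint_sum_contfun disjoint_sum_contfun_linear.

Lemma disjoint_sum_isometry (x : c0 R kappa) :
  `|disjoint_sum_contfun x| = `|x|.
Proof.
rewrite contfun_normE c0_normE; apply/eqP; rewrite eq_le; apply/andP; split.
  apply: sup_norm_le => [|y]; first exact: sup_norm_ge0.
  rewrite /= /disjoint_sum; case yE: (index y) => [a|]; last first.
    by rewrite normr0 sup_norm_ge0.
  rewrite normrM -[leRHS]mulr1 ler_pM//.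
    exact: sup_norm_ub (c0_bounded x).
  by apply: C_le1; rewrite -(phi_image a); exists y => //; exact: index_Some.
apply: sup_norm_le => [|a]; first exact: sup_norm_ge0.
(* The norm of [x] is not diminished because [phi a] takes the value 1 on [U a]. *)
have [y Uay y1] : (phi a @` U a) 1 by rewrite phi_image.
have <- : disjoint_sum x y = x a by rewrite (disjoint_sumE _ Uay) y1 mulr1.
exact: sup_norm_ub (contfun_bounded (disjoint_sum_contfun x)).
Qed.

Lemma range_disjoint_sum (x : c0 R kappa) : x != 0 ->
  range (disjoint_sum x) = star_union x C.
Proof.
move=> x_neq0; apply/seteqP; split=> [_ [y _ <-]|_ [a [t Ct ->]]].
  rewrite /= /disjoint_sum; case yE: (index y) => [a|].
    exists a, (phi a y) => //; rewrite -(phi_image a).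
    by exists y => //; exact: index_Some.
  (* Off the union the value is 0, which needs some index [a] to be written as [x a * 0]. *)
  have [a _] : exists a, x a != 0.
    by apply: fun_neq0 => x0; case/eqP: x_neq0; exact: val_inj.
  by exists a, 0; rewrite ?mulr0.
have [y Uay yt] : (phi a @` U a) t by rewrite phi_image.
by exists y => //; rewrite (disjoint_sumE _ Uay) yt.
Qed.

End DisjointSums.

(** * Ranges for the unit interval *)

Lemma proper_interval_star_union (R : realType) (I : Type) (x : I -> R) :
  x <> (fun=> 0) -> proper_interval (star_union x `[0, 1]).
Proof.
move=> /fun_neq0[a xa].
(* The union is star-shaped about 0, which on the line yields order convexity: a point between [r]
   and [s] lies between 0 and one of them. *)
have shrink r l : star_union x `[0, 1] r -> 0 <= l <= 1 ->
    star_union x `[0, 1] (l * r).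
  move=> [b [t /= + ->]]; rewrite in_itv /= => /andP[t0 t1] /andP[l0 l1].
  exists b, (l * t); last by rewrite mulrCA.
  by rewrite /= in_itv /= mulr_ge0// mulr_ile1.
have xaE : star_union x `[0, 1] (x a).
  by exists a, 1; rewrite ?mulr1//= in_itv /= lexx ler01.
have E0 : star_union x `[0, 1] 0.
  by have := shrink _ 0 xaE; rewrite mul0r lexx ler01; exact.
split=> [r s Er Es z /andP[rz zs]|]; last first.
  by have [lt|gt|eq0] := ltgtP (x a) 0;
    [exists (x a), 0 | exists 0, (x a) | rewrite eq0 eqxx in xa].
have [z0|z0|->//] := ltgtP z 0.
  have r0 : r < 0 by lra.
  rewrite -(divfK (ltr0_neq0 r0) z); apply: shrink => //.
  by rewrite mulr_le0 ?invr_le0 ?(ltW z0) ?(ltW r0)//= ler_ndivrMr// mul1r.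
have s0 : 0 < s by lra.
rewrite -(divfK (lt0r_neq0 s0) z); apply: shrink => //.
by rewrite divr_ge0 ?(ltW z0) ?(ltW s0)//= ler_pdivrMr// mul1r.
Qed.

Lemma proper_interval_continuum (R : realType) (E : set R) :
  proper_interval E -> has_card_continuum E.
Proof.
move=> [itvE [u [v [Eu Ev uv]]]]; rewrite /has_card_continuum card_eq_le.
apply/andP; split; first exact: subset_card_le.
(* [contract] injects the reals into the open interval from -1 to 1; the affine map carries that
   onto the one from [u] to [v]. *)
pose f (r : R) := (u + v) / 2 + (v - u) / 2 * contract r%:E.
have f_inj : injective f.
  have uv2 : (v - u) / 2 != 0 by apply: lt0r_neq0; lra.
  by move=> r s /addrI/(mulfI uv2)/contract_inj[].
have -> : [set: R] = f @^-1` E.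
  apply/seteqP; split=> // r _; apply: (itvE _ _ Eu Ev).
  have := contract_lt1 r; rewrite ltr_norml => /andP[c1 c2].
  rewrite /f; apply/andP; split; nra.
by apply: card_ge_preimage => r s _ _; exact: f_inj.
Qed.

(** * Ranges for a perfect nowhere dense set *)

Lemma dense_between (R : realType) (D : set R) :
  (forall u v, u < v -> exists z, [/\ u < z, z < v & D z]) -> dense D.
Proof.
move=> gapD O [x Ox] oO.
have /nbhs_ballP[e /= e0 xeO] := open_nbhs_nbhs (conj oO Ox).
have [|z [xz zxe Dz]] := gapD x (x + e); first by rewrite ltrDl.
exists z; split=> //; apply: xeO.
by rewrite /ball /= ltr0_norm ?subr_lt0//; lra.
Qed.

(** Each [c * C] is compact with dense complement, and a finite intersection of open dense sets is
    open and dense. *)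
Lemma dense_avoid_scaled (R : realType) (C : set R) (s : seq R) :
  compact C ->
  (forall u v, u < v -> exists z, [/\ u < z, z < v & ~ C z]) ->
  let A := [set z | forall c t, c \in s -> C t -> z <> c * t] in
  open A /\ dense A.
Proof.
move=> cC gapC; elim: s => [|c s [IHo IHd]] A.
  have -> : A = setT by apply/seteqP; split.
  by split; [exact: openT | move=> O [x Ox] _; exists x].
pose B := ~` ([eta *%R c] @` C).
have AE : A = B `&` [set z | forall c t, c \in s -> C t -> z <> c * t].
  apply/seteqP; split=> [z Az|z [Bz Sz] d t].
    split=> [[t Ct ct]|d t sd].
      by apply: (Az c t) => //; rewrite mem_head.
    by apply: Az; rewrite inE sd orbT.
  rewrite inE => /predU1P[->|]; last exact: Sz.
  by move=> Ct zE; apply: Bz; exists t.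
have oB : open B.
  apply: closed_openC; apply: compact_closed; first exact: Rhausdorff.
  apply: continuous_compact => //; apply: continuous_subspaceT => x.
  by apply: cvgM; [exact: cvg_cst | exact: cvg_id].
have dB : dense B.
  (* For [c = 0] the scaled set is at most a point; otherwise gaps of [C] scale, with endpoints
     swapped when [c < 0]. *)
  have [c_eq0|c_neq0] := eqVneq c 0.
    move=> O O_ne oO; have [z [Oz z0]] := @dense_set1C R 0 O O_ne oO.
    by exists z; split=> // -[t _ tz]; apply: z0; rewrite /= -tz c_eq0 mul0r.
  apply: dense_between => u v uv.
  suff [z [uz zv nCz]] : exists z, [/\ u < c * z, c * z < v & ~ C z].
    exists (c * z); split=> // -[t Ct /(mulfI c_neq0) tz].
    by apply: nCz; rewrite -tz.
  have [c0|c0|c0] := ltgtP c 0; last by rewrite c0 eqxx in c_neq0.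
    have [|z [vz zu nCz]] := gapC (v / c) (u / c).
      by rewrite ltr_nM2r ?invr_lt0.
    move: vz zu; rewrite ltr_ndivrMr// ltr_ndivlMr// ![z * c]mulrC => cz_v u_cz.
    by exists z.
  have [|z [uz zv nCz]] := gapC (u / c) (v / c).
    by rewrite ltr_pM2r ?invr_gt0.
  move: uz zv; rewrite ltr_pdivrMr// ltr_pdivlMr// ![z * c]mulrC => u_cz cz_v.
  by exists z.
by rewrite AE; split; [exact: openI | exact: denseI].
Qed.

Lemma star_union_gap (R : realType) (I : Type) (x : c0 R I) (C : set R) :
  compact C -> (forall t, C t -> `|t| <= 1) ->
  (forall u v, u < v -> exists z, [/\ u < z, z < v & ~ C z]) ->
  forall u v, u < v -> exists z, [/\ u < z, z < v & ~ star_union x C z].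
Proof.
move=> cC C_le1 gapC u v uv.
(* Staying at distance [e] from 0, only the finitely many [a] with [e < `|x a|]
   matter. *)
have [u' [v' [e [e0 uu' uv' vv' far]]]] : exists u' v' e : R,
    [/\ 0 < e, u <= u', u' < v', v' <= v & forall z, u' < z < v' -> e < `|z|].
  have [v0|v0] := ltP 0 v.
    (* An end of the interval away from 0 is kept: the right one if [v > 0], else the left one. *)
    exists (Num.max u (v / 2)), v, (v / 2).
    rewrite le_max lexx gt_max uv; split=> //; try lra.
    move=> z; rewrite gt_max => /andP[/andP[_ vz] _].
    by rewrite gtr0_norm//; lra.
  exists u, (Num.min v (u / 2)), (- u / 2).
  rewrite ge_min lexx lt_min uv; split=> //; try lra.
  move=> z; rewrite lt_min => /andP[_ /andP[_ zu]].
  by rewrite ltr0_norm//; lra.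
have := c0P x; rewrite inE => /(_ e e0) /(finite_image x)/finite_seqP[s sE].
have [oA dA] := dense_avoid_scaled s cC gapC.
have [||z [/= + Az]] := dA [set` `]u', v'[].
- by exists ((u' + v') / 2); rewrite /= in_itv /=; apply/andP; split; lra.
- exact: interval_open.
rewrite in_itv /= => uzv; exists z.
have /andP[uz zv] := uzv; split; [lra|lra|] => -[a [t Ct zE]].
apply: (Az (x a) t) => //.
(* As [|t| <= 1], the coordinate [x a] is at least [|z| > e] in absolute value, hence listed in
   [s]. *)
have : [set` s] (x a); last by [].
rewrite -sE; exists a => //=; apply: lt_le_trans (far _ uzv) _.
by rewrite zE normrM -[leRHS]mulr1 ler_wpM2l// C_le1.
Qed.

(** Two points are separated by cutting at some [z] between them outside [E]: on [E] the conditions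
    [< z] and [<= z] agree, so the cut is clopen. *)
Lemma zero_dimensional_set_type (R : realType) (E : set R) :
  (forall u v, u < v -> exists z, [/\ u < z, z < v & ~ E z]) ->
  zero_dimensional (set_type E).
Proof.
move=> gapE.
have below_clopen z : ~ E z -> clopen [set w : set_type E | set_val w < z].
  move=> nEz; split.
    exact: open_comp (fun w _ => @initial_continuous _ _ _ w) (@open_lt _ z).
  have -> : [set w : set_type E | set_val w < z] =
      set_val @^-1` [set r | r <= z].
    apply/seteqP; split=> w /=; first exact: ltW.
    rewrite le_eqVlt => /predU1P[wz|//].
    by case: nEz; rewrite -wz; exact: set_valP.
  exact: closed_comp (fun w _ => @initial_continuous _ _ _ w) (@closed_le _ z).
move=> x y xy.
have : set_val x != set_val y by apply: contraNN xy => /eqP/val_inj ->.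
rewrite neq_lt => /orP[lt_xy|lt_yx].
  have [z [xz zy /below_clopen clz]] := gapE _ _ lt_xy.
  by exists [set w | set_val w < z]; split=> //= /(lt_trans zy); rewrite ltxx.
have [z [yz zx /below_clopen clz]] := gapE _ _ lt_yx.
exists (~` [set w | set_val w < z]); split; first exact: (clopenC setT clz).
  by move=> /= /(lt_trans zx); rewrite ltxx.
by apply; exact: yz.
Qed.

Lemma perfect_set_type (R : realType) (E : set R) :
  (forall r e, E r -> 0 < e -> exists s, [/\ E s, s != r & `|s - r| < e]) ->
  perfect_set [set: set_type E].
Proof.
move=> accE; apply/perfectTP => r [V oV VE].
have Vr : V (set_val r) by have : [set r] r by []; rewrite -VE.
have /nbhs_ballP[e /= e0 reV] := open_nbhs_nbhs (conj oV Vr).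
have [s [Es /eqP sr rs]] := accE _ e (set_valP r) e0.
have : [set r] (exist _ s (mem_set Es)).
  by rewrite -VE; apply: reV; rewrite /ball /= distrC.
by move=> rE; apply: sr; rewrite -rE.
Qed.

Lemma star_union_no_isolated (R : realType) (I : Type) (x : I -> R)
    (C : set R) :
  C 0 -> x <> (fun=> 0) ->
  (forall t e, C t -> 0 < e -> exists s, [/\ C s, s != t & `|s - t| < e]) ->
  forall r e, star_union x C r -> 0 < e ->
    exists s, [/\ star_union x C s, s != r & `|s - r| < e].
Proof.
move=> C0 /fun_neq0[b xb] accC r e [a [t Ct rE]] e0.
(* If [x a = 0] then [r = 0], rewritten as [x b * 0] so that nearby points of [C] can be scaled by a
   nonzero factor. *)
have [d [u [Cu xd ->]]] : exists d u, [/\ C u, x d != 0 & r = x d * u].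
  have [xa|xa] := eqVneq (x a) 0; last by exists a, t.
  by exists b, 0; rewrite rE xa mul0r mulr0.
have [|s [Cs su lt_su]] := accC u (e / `|x d|) Cu.
  by rewrite divr_gt0 ?normr_gt0.
exists (x d * s); split; first by exists d, s.
  by apply: contraNN su => /eqP/(mulfI xd) ->.
by rewrite -mulrBr normrM mulrC -ltr_pdivlMr ?normr_gt0.
Qed.

(** * The three copies of the sequence space *)

Lemma c0_copy (R : realType) (K : topologicalType) (cK : compact [set: K])
    (kappa : Type) (U : kappa -> set K) (C : set R) (S : set (contfun R cK)) :
  trivIset [set: kappa] U -> (forall a, clopen (U a)) ->
  (forall a, admits_clopen_cantor_scheme (U a)) ->
  compact C -> C 0 -> C 1 -> (forall t, C t -> `|t| <= 1) ->
  (forall (f : contfun R cK) (x : c0 R kappa), x != 0 ->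
     range f = star_union x C -> S f) ->
  contains_isometric_copy (c0 R kappa) (S `|` [set 0]).
Proof.
move=> U_disj U_clopen U_scheme cC C0 C1 C_le1 SP.
have [g cg gC] := cantor_surj_set cC (ex_intro _ 0 C0).
have /choice[phi phiP] a :
    exists phi : K -> R, continuous phi /\ phi @` U a = C.
  have [A [schA clA]] := U_scheme a.
  (* The code is defined on all of [K], and its restriction to [U a] is already onto the Cantor
     space. *)
  exists (g \o scheme_code A); split.
    move=> y; apply: continuous_comp; last exact: cg.
    exact: scheme_code_continuous.
  rewrite -gC; apply/seteqP; split=> [_ [y _ <-]|_ [b _ <-]].
    by exists (scheme_code A y).
  have [y Uy yb] := scheme_code_surj b cK schA (fun s => (clA s).2).
  by exists y => //=; rewrite yb.
have phi_cont a := (phiP a).1; have phi_image a := (phiP a).2.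
pose T : {linear c0 R kappa -> contfun R cK} :=
  disjoint_sum_contfun cK U_disj U_clopen phi_cont phi_image C_le1.
exists (range T); split; first exists T.
  split=> // x; exact: disjoint_sum_isometry.
move=> _ [x _ <-]; have [->|x_neq0] := eqVneq x 0.
  by right; rewrite linear0.
by left; apply: (SP _ x) => //; exact: range_disjoint_sum.
Qed.

Theorem corollary9 (R : realType) (K : topologicalType)
    (cK : compact [set: K]) (kappa : Type) (U : kappa -> set K)
    (U_disjoint : trivIset [set: kappa] U)
    (U_nonempty : forall a, U a !=set0)
    (U_clopen : forall a, clopen (U a))
    (U_scheme : forall a, admits_clopen_cantor_scheme (U a)) :
  [/\ contains_isometric_copy (c0 R kappa)
        ([set f : contfun R cK | has_card_continuum (range f)] `|` [set 0]),
      contains_isometric_copy (c0 R kappa)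
        ([set f : contfun R cK | proper_interval (range f)] `|` [set 0]) &
      contains_isometric_copy (c0 R kappa)
        ([set f : contfun R cK | homeomorphic_to_cantor (range f)] `|` [set 0])].
Proof.
have c0_val_neq0 (x : c0 R kappa) : x != 0 -> c0_val x <> (fun=> 0).
  by move=> x_neq0 x0; case/eqP: x_neq0; exact: val_inj.
have le1_itv (t : R) : 0 <= t <= 1 -> `|t| <= 1.
  by move=> /andP[t0 t1]; rewrite ger0_norm.
(* One embedding, with [C] the unit interval, serves the first two claims. *)
have itv_copy (S : set (contfun R cK)) :
    (forall f : contfun R cK, proper_interval (range f) -> S f) ->
    contains_isometric_copy (c0 R kappa) (S `|` [set 0]).
  move=> SP; apply: (c0_copy U_disjoint U_clopen U_scheme
    (@segment_compact R 0 1)).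
  + by rewrite /= in_itv /= lexx ler01.
  + by rewrite /= in_itv /= lexx ler01.
  + by move=> t; rewrite /= in_itv; exact: le1_itv.
  move=> f x /c0_val_neq0 x_neq0 fE; apply: SP; rewrite fE.
  exact: proper_interval_star_union.
split.
- by apply: itv_copy => f; exact: proper_interval_continuum.
- exact: itv_copy.
- apply: (c0_copy U_disjoint U_clopen U_scheme (@compact_ternary_set R)).
  + exact: ternary_set0.
  + exact: ternary_set1.
  + by move=> t /ternary_set01; exact: le1_itv.
  move=> f x /c0_val_neq0 x_neq0 fE /=; have [a _] := fun_neq0 x_neq0.
  have ternary_le1 (t : R) : ternary_set t -> `|t| <= 1.
    by move=> /ternary_set01; exact: le1_itv.
  apply: homeomorphic_to_cantorP.
    by rewrite fE; exists 0; exists a, 0; [exact: ternary_set0 | rewrite mulr0].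
  have cf : compact (range f).
    apply: continuous_compact => //; apply: continuous_subspaceT.
    by have := contfunP f; rewrite inE.
  (* The four conditions of [cantor_like]: perfect, compact, Hausdorff, zero-dimensional. *)
  split.
  + rewrite fE; apply: perfect_set_type; apply: star_union_no_isolated => //.
      exact: ternary_set0.
    by move=> t e Ct e0; exact: ternary_set_perfect.
  + exact: compact_set_type.
  + exact: hausdorff_set_type (@Rhausdorff R).
  + rewrite fE; apply: zero_dimensional_set_type; apply: star_union_gap => //.
      exact: compact_ternary_set.
    exact: ternary_set_gap.
Qed.
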